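(* For $n\in\mathbb{N}$, $\mathcal{R}_n = \left(\frac{\pi}{2}-1\right)n+O\left(\sqrt{n}\right)$, and hence $\lim_{n\to\infty}\frac{1}{n}\mathcal{R}_n=\frac{\pi}{2}-1$.
   Context: $\mathbb{N}$ denotes the set of positive integers. The nearest integer function $\mathrm{nint}$ rounds a real number to the nearest integer, with half-integers rounded up: $\mathrm{nint}(x)=\max\{z\in\mathbb{Z} : |z-x|\le |z'-x|\text{ for all } z'\in\mathbb{Z}\}=\lfloor x+1/2\rfloor$. For $n\in\mathbb{N}$, $\mathcal{R}_n = \#\{k\in\mathbb{Z} : 1\le k\le n,\ \mathrm{nint}(n/k)\text{ is odd}\}$. Big O notation: $f(n)=O(g(n))$ means there exist constants $M$ and $a$ such that $|f(n)|\le M g(n)$ for all $n\ge a$. *)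

(* Defs.v *)
From Stdlib Require Import Reals Lra Lia ZArith List.
From Coquelicot Require Import Coquelicot.
Open Scope R_scope.

(* [Int_part] is the floor function on all of [R], negative reals included. *)
Definition nint (x : R) : Z := Int_part (x + / 2).

Definition is_nearest (x : R) (z : Z) : Prop :=
  forall z' : Z, Rabs (IZR z - x) <= Rabs (IZR z' - x).

(* [nint x] is the largest of the integers nearest to [x]. *)
Lemma nint_max (x : R) :
  is_nearest x (nint x) /\ (forall z : Z, is_nearest x z -> (z <= nint x)%Z).
Proof.
destruct (base_Int_part (x + / 2)) as [H1 H2]; fold (nint x) in H1, H2.
split.
- intros z'.
  destruct (Z.lt_trichotomy z' (nint x)) as [H | [H | H]].
  + assert (H' : (z' <= nint x - 1)%Z) by lia.
    apply IZR_le in H'; rewrite minus_IZR in H'.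
    unfold Rabs; destruct (Rcase_abs _), (Rcase_abs _); lra.
  + rewrite H; lra.
  + assert (H' : (nint x + 1 <= z')%Z) by lia.
    apply IZR_le in H'; rewrite plus_IZR in H'.
    unfold Rabs; destruct (Rcase_abs _), (Rcase_abs _); lra.
- intros z Hz.
  destruct (Z_le_gt_dec z (nint x)) as [H | H]; [exact H | exfalso].
  assert (H' : (nint x + 1 <= z)%Z) by lia.
  apply IZR_le in H'; rewrite plus_IZR in H'.
  specialize (Hz (z - 1)%Z); rewrite minus_IZR in Hz; revert Hz.
  unfold Rabs; destruct (Rcase_abs _), (Rcase_abs _); lra.
Qed.

(* The number of integers k with 1 <= k <= n and nint (n / k) odd. *)
Definition odd_count (n : nat) : nat :=
  length (filter (fun k : nat => Z.odd (nint (INR n / INR k))) (seq 1 n)).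

(* f(n) = O(g(n)) for functions of a positive integer; values at 0 are ignored. *)
Definition bigO (f g : nat -> R) : Prop :=
  exists M a : R, forall n : nat,
    (1 <= n)%nat -> a <= INR n -> Rabs (f n) <= M * g n.

(* Main.v *)
(* The quotient n / k rounds to at least m exactly when k <= 2 n / (2 m - 1),
   which happens for 2 n / (2 m - 1) + O(1) values of k when m >= 2, and for all n values
   when m = 1.  Hence the k for which n / k rounds to an odd number that is at most 2 J
   number 2 n (1 - 1/3 + 1/5 - ... - 1/(4 J - 1)) - n + O(J), and at most
   2 n / (4 J + 1) further values of k round to something larger.  Leibniz's series for
   PI / 4, truncated at 2 J terms, is off by at most 1 / (4 J - 1), so that J ~ sqrt n
   balances the errors. *)
Require Import Defs.
From Stdlib Require Import Reals Lra Lia ZArith List Bool.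
From Coquelicot Require Import Coquelicot.
Open Scope R_scope.

Lemma filter_length_disjoint {A : Type} (f g h : A -> bool) (l : list A) :
  (forall x, In x l -> h x = f x || g x) ->
  (forall x, In x l -> f x && g x = false) ->
  length (filter h l) = (length (filter f l) + length (filter g l))%nat.
Proof.
induction l as [|a l IH]; intros Hh Hd; [reflexivity|].
assert (IHl : length (filter h l) = (length (filter f l) + length (filter g l))%nat).
{ apply IH; intros x Hx; [apply Hh | apply Hd]; right; exact Hx. }
specialize (Hh a (or_introl eq_refl)); specialize (Hd a (or_introl eq_refl)).
simpl; rewrite Hh; destruct (f a), (g a); simpl in *; try discriminate; lia.
Qed.

Lemma filter_leb_seq_length (b n : nat) :
  length (filter (fun k => Nat.leb k b) (seq 1 n)) = Nat.min n b.
Proof.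
induction n as [|n IH]; [reflexivity|].
rewrite seq_S, filter_app, length_app, IH; cbn [filter].
destruct (Nat.leb_spec (1 + n) b) as [H|H]; cbn [length]; lia.
Qed.

(** Rounding reaches m exactly when m <= n / k + 1/2. Multiplying by 2 k > 0 clears the denominators
    and leaves an inequality between integers. *)
Lemma le_nint_ratio (n k : nat) (m : Z) :
  (1 <= k)%nat ->
  (m <= nint (INR n / INR k))%Z <-> ((2 * m - 1) * Z.of_nat k <= 2 * Z.of_nat n)%Z.
Proof.
intros Hk.
assert (Hk0 : 0 < INR k) by (apply lt_0_INR; lia).
unfold nint; destruct (base_Int_part (INR n / INR k + / 2)) as [H1 H2].
set (v := Int_part _) in *.
assert (Hx : INR n = INR n / INR k * INR k) by (field; lra).
set (x := INR n / INR k) in *.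
split; intros H.
- apply le_IZR; rewrite !mult_IZR, minus_IZR, mult_IZR, <- !INR_IZR_INZ, Hx.
  apply IZR_le in H; nra.
- apply IZR_le in H; rewrite !mult_IZR, minus_IZR, mult_IZR, <- !INR_IZR_INZ, Hx in H.
  assert (Hm : 2 * IZR m - 1 <= 2 * x) by nra.
  assert (Hlt : IZR m < IZR (v + 1)) by (rewrite plus_IZR; lra).
  apply lt_IZR in Hlt; lia.
Qed.

(** Tail counts are used because their condition on k is a single upper bound; the count of one
    value is a difference of two of them. *)
Definition count_ge (n : nat) (m : Z) : nat :=
  length (filter (fun k => Z.leb m (nint (INR n / INR k))) (seq 1 n)).

(** The cutoff is even, so that raising J by one admits a single new odd value, 2 J + 1. *)
Definition odd_count_upto (n J : nat) : nat :=
  length (filter (fun k => Z.odd (nint (INR n / INR k))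
                           && Z.leb (nint (INR n / INR k)) (2 * Z.of_nat J))
                 (seq 1 n)).

(** The threshold is shifted to m + 1 so that the denominator 2 (m + 1) - 1 becomes 2 m + 1, as in
    Leibniz's series. *)
Lemma count_ge_min (n m : nat) :
  count_ge n (Z.of_nat m + 1) = Nat.min n (2 * n / (2 * m + 1)).
Proof.
rewrite <- filter_leb_seq_length; unfold count_ge; f_equal.
apply filter_ext_in; intros k Hk; apply in_seq in Hk.
apply eq_true_iff_eq; rewrite Z.leb_le, Nat.leb_le, le_nint_ratio by lia.
split; intros H.
- apply Nat.div_le_lower_bound; lia.
- assert (Hd := Nat.Div0.mul_div_le (2 * n) (2 * m + 1)); nia.
Qed.

Lemma div_bounds (a d : nat) :
  (0 < d)%nat -> INR a / INR d - 1 <= INR (a / d) <= INR a / INR d.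
Proof.
intros Hd.
assert (Hd0 : 0 < INR d) by (apply lt_0_INR; lia).
assert (H1 : (d * (a / d) <= a)%nat) by apply Nat.Div0.mul_div_le.
assert (H2 : (a <= d * (a / d + 1))%nat).
{ assert (H := Nat.mul_succ_div_gt a d); lia. }
apply le_INR in H1, H2; rewrite mult_INR in H1, H2; rewrite plus_INR in H2; simpl (INR 1) in H2.
assert (Ha : INR a = INR a / INR d * INR d) by (field; lra).
set (x := INR a / INR d) in *; split; nra.
Qed.

Lemma count_ge_1 (n : nat) : count_ge n 1 = n.
Proof.
change 1%Z with (Z.of_nat 0 + 1)%Z; rewrite count_ge_min.
replace (2 * 0 + 1)%nat with 1%nat by lia; rewrite Nat.div_1_r; lia.
Qed.

(** For m >= 1 the quotient 2 n / (2 m + 1) is at most n, so the minimum disappears and only the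
    floor contributes an error. *)
Lemma count_ge_bounds (n m : nat) :
  (1 <= m)%nat ->
  2 * INR n * PI_tg m - 1 <= INR (count_ge n (Z.of_nat m + 1)) <= 2 * INR n * PI_tg m.
Proof.
intros Hm; rewrite count_ge_min.
assert (Hle : (2 * n / (2 * m + 1) <= n)%nat).
{ apply Nat.Div0.div_le_upper_bound; nia. }
rewrite Nat.min_r by exact Hle.
assert (H := div_bounds (2 * n) (2 * m + 1) ltac:(lia)).
(* [PI_tg m] unfolds to [/ INR (2 * m + 1)], so the bounds agree by conversion. *)
rewrite (mult_INR 2 n) in H; exact H.
Qed.

(** The quotient is nonnegative, so a rounded value at most 0 equals 0, which is even. *)
Lemma odd_count_upto_0 (n : nat) : odd_count_upto n 0 = 0%nat.
Proof.
unfold odd_count_upto.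
rewrite (filter_ext_in _ (fun _ => false)).
- induction (seq 1 n); auto.
- intros k Hk; apply in_seq in Hk.
  assert (H : (0 <= nint (INR n / INR k))%Z) by (apply le_nint_ratio; lia).
  destruct (Z.leb_spec (nint (INR n / INR k)) (2 * Z.of_nat 0)) as [H'|H'].
  + replace (nint (INR n / INR k)) with 0%Z by lia; reflexivity.
  + apply andb_false_r.
Qed.

Lemma odd_le_even (v j : Z) : Z.odd v = true -> (v <= 2 * j)%Z -> (v <= 2 * j - 1)%Z.
Proof. rewrite Z.odd_spec; intros [p Hp]; lia. Qed.

(** The new k are those with rounded value 2 J + 1, and their number is the difference of the two
    tail counts. Both sides are kept as sums to avoid truncated subtraction. *)
Lemma odd_count_upto_S (n J : nat) :
  (odd_count_upto n (S J) + count_ge n (Z.of_nat (2 * J + 1) + 1))%nat =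
  (odd_count_upto n J + count_ge n (Z.of_nat (2 * J) + 1))%nat.
Proof.
unfold odd_count_upto, count_ge; set (v := fun k : nat => nint (INR n / INR k)).
set (one := fun k => Z.eqb (v k) (2 * Z.of_nat J + 1)).
assert (Hone : forall k, one k = true -> Z.odd (v k) = true).
{ unfold one; intros k Hk; apply Z.eqb_eq in Hk; rewrite Hk, Z.odd_spec.
  exists (Z.of_nat J); reflexivity. }
rewrite (filter_length_disjoint
           (fun k => Z.odd (v k) && Z.leb (v k) (2 * Z.of_nat J)) one
           (fun k => Z.odd (v k) && Z.leb (v k) (2 * Z.of_nat (S J)))).
- rewrite (filter_length_disjoint one (fun k => Z.leb (Z.of_nat (2 * J + 1) + 1) (v k))
             (fun k => Z.leb (Z.of_nat (2 * J) + 1) (v k))).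
  + apply eq_sym, Nat.add_assoc.
  + intros k _; unfold one; apply eq_true_iff_eq.
    rewrite orb_true_iff, !Z.leb_le, Z.eqb_eq; lia.
  + intros k _; unfold one; apply not_true_is_false.
    rewrite andb_true_iff, Z.leb_le, Z.eqb_eq; lia.
- intros k _; apply eq_true_iff_eq.
  rewrite orb_true_iff, !andb_true_iff, !Z.leb_le; split.
  (* By parity, an odd value at most 2 J + 2 is at most 2 J + 1. *)
  + intros [Ho Hle]; assert (H := odd_le_even _ _ Ho Hle).
    destruct (Z.eq_dec (v k) (2 * Z.of_nat J + 1)) as [E|E].
    * right; unfold one; apply Z.eqb_eq, E.
    * left; split; [exact Ho | lia].
  + intros [[Ho Hle]|H]; [split; [exact Ho | lia]|].
    split; [apply Hone, H|]; unfold one in H; apply Z.eqb_eq in H; lia.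
- intros k _; unfold one; apply not_true_is_false.
  rewrite !andb_true_iff, Z.leb_le, Z.eqb_eq; lia.
Qed.

(** Odd values beyond 2 J are bounded crudely by all values beyond 2 J. *)
Lemma odd_count_bounds (n J : nat) :
  (odd_count_upto n J <= odd_count n
   <= odd_count_upto n J + count_ge n (Z.of_nat (2 * J) + 1))%nat.
Proof.
unfold odd_count, odd_count_upto, count_ge; set (v := fun k : nat => nint (INR n / INR k)).
induction (seq 1 n) as [|k l IH]; cbn [filter length]; [lia|].
change (nint (INR n / INR k)) with (v k) in *.
destruct (Z.odd (v k)), (Z.leb_spec (v k) (2 * Z.of_nat J)),
  (Z.leb_spec (Z.of_nat (2 * J) + 1) (v k)); cbn [andb length] in *; lia.
Qed.

(* The offset [- INR n] comes from [m = 1]: [n / k] rounds to at least 1 for [n], not [2 n],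
   values of [k]. *)
Lemma odd_count_upto_leibniz (n N : nat) :
  Rabs (INR (odd_count_upto n (S N))
        - (2 * INR n * sum_f_R0 (tg_alt PI_tg) (S (2 * N)) - INR n)) <= 2 * INR (S N).
Proof.
(* The series is taken in pairs 1/(4 m + 1) - 1/(4 m + 3), one for each odd value 2 m + 1. *)
assert (Hpair : forall m, tg_alt PI_tg (2 * m) = PI_tg (2 * m)
                       /\ tg_alt PI_tg (S (2 * m)) = - PI_tg (2 * m + 1)).
{ intros m; unfold tg_alt; rewrite pow_1_even, pow_1_odd.
  replace (2 * m + 1)%nat with (S (2 * m)) by lia; lra. }
induction N as [|N IH].
- assert (H := odd_count_upto_S n 0); rewrite odd_count_upto_0 in H.
  change (Z.of_nat (2 * 0) + 1)%Z with 1%Z in H; rewrite count_ge_1 in H.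
  apply (f_equal INR) in H; rewrite !plus_INR in H; simpl (INR 0) in H.
  assert (Hc := count_ge_bounds n (2 * 0 + 1) ltac:(lia)).
  destruct (Hpair 0%nat) as [E0 E1].
  assert (P0 : PI_tg (2 * 0) = 1) by (unfold PI_tg; simpl; lra).
  rewrite tech5; change (sum_f_R0 (tg_alt PI_tg) (2 * 0)) with (tg_alt PI_tg (2 * 0)).
  rewrite E0, E1, P0; simpl (INR 1); apply Rabs_le; nra.
- assert (H := odd_count_upto_S n (S N)).
  apply (f_equal INR) in H; rewrite !plus_INR in H.
  (* Each of the two tail counts is off by at most 1, which the growth of the bound by 2 absorbs. *)
  assert (Hc0 := count_ge_bounds n (2 * S N) ltac:(lia)).
  assert (Hc1 := count_ge_bounds n (2 * S N + 1) ltac:(lia)).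
  destruct (Hpair (S N)) as [E0 E1].
  rewrite tech5, E1.
  replace (sum_f_R0 (tg_alt PI_tg) (2 * S N))
    with (sum_f_R0 (tg_alt PI_tg) (S (2 * N)) + PI_tg (2 * S N)).
  2:{ rewrite <- E0; replace (2 * S N)%nat with (S (S (2 * N))) by lia; reflexivity. }
  rewrite (S_INR (S N)).
  apply Rabs_le_between in IH; apply Rabs_le; lra.
Qed.

(** The series alternates, so PI / 4 lies between two consecutive partial sums, which differ by the
    last term. *)
Lemma leibniz_remainder (N : nat) :
  0 <= PI / 4 - sum_f_R0 (tg_alt PI_tg) (S (2 * N)) <= PI_tg (2 * N + 1).
Proof.
assert (H := Alt_PI_ineq N); rewrite Alt_PI_eq, tech5 in H; rewrite tech5.
replace (tg_alt PI_tg (S (2 * N))) with (- PI_tg (2 * N + 1)) in *; [lra|].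
unfold tg_alt; rewrite pow_1_odd; replace (2 * N + 1)%nat with (S (2 * N)) by lia; lra.
Qed.

(** Take J = N + 1 with N the integer part of s = sqrt n. The floors cost at most 2 (N + 1) <= 4 s,
    the values beyond 2 J at most s, and the remainder of the series at most s, whence the constant
    6. *)
Lemma odd_count_error (n : nat) :
  (1 <= n)%nat ->
  Rabs (INR (odd_count n) - (PI / 2 - 1) * INR n) <= 6 * sqrt (INR n).
Proof.
intros Hn; set (N := Nat.sqrt n); set (s := sqrt (INR n)).
assert (Hn0 : 1 <= INR n) by (apply (le_INR 1), Hn).
assert (Hs : s * s = INR n) by (apply sqrt_sqrt; lra).
assert (Hs1 : 1 <= s) by (rewrite <- sqrt_1; apply sqrt_le_1; lra).
assert (HN : INR N <= s <= INR N + 1).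
{ destruct (Nat.sqrt_spec n (Nat.le_0_l n)) as [H1 H2]; fold N in H1, H2.
  apply le_INR in H1; apply lt_INR in H2; rewrite mult_INR in H1, H2.
  rewrite S_INR in H2; assert (H := pos_INR N); split; nra. }
(* Here 2 m + 1 >= 2 (N + 1) >= 2 s, and 2 n / (2 s) = s. This serves both the tail and the series
   remainder. *)
assert (Htg : forall m, (2 * N + 1 <= m)%nat -> 0 < PI_tg m /\ 2 * INR n * PI_tg m <= s).
{ intros m Hm; unfold PI_tg; apply le_INR in Hm.
  rewrite plus_INR, mult_INR in Hm; simpl (INR 2) in Hm; simpl (INR 1) in Hm.
  assert (HI : INR (2 * m + 1) = 2 * INR m + 1).
  { rewrite plus_INR, mult_INR; simpl; lra. }
  rewrite HI; assert (HmP : 2 * s <= 2 * INR m + 1) by (assert (H := pos_INR N); lra).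
  split; [apply Rinv_0_lt_compat; lra|].
  apply Rle_div_l; [lra|]; nra. }
destruct (Htg (2 * N + 1)%nat ltac:(lia)) as [_ Hr].
destruct (Htg (2 * S N)%nat ltac:(lia)) as [_ Ht].
assert (HC := count_ge_bounds n (2 * S N) ltac:(lia)).
destruct (odd_count_bounds n (S N)) as [Hlo Hhi].
apply le_INR in Hlo, Hhi; rewrite plus_INR in Hhi.
assert (HA := odd_count_upto_leibniz n N); rewrite S_INR in HA; apply Rabs_le_between in HA.
destruct (leibniz_remainder N) as [Hp0 Hp1].
set (S := sum_f_R0 _ _) in *.
assert (HP0 : 0 <= 2 * INR n * (PI / 4 - S)) by nra.
assert (HP1 : 2 * INR n * (PI / 4 - S) <= s) by nra.
apply Rabs_le; lra.
Qed.

Theorem proposition3p8 :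
  bigO (fun n : nat => INR (odd_count n) - (PI / 2 - 1) * INR n)
       (fun n : nat => sqrt (INR n))
  /\ is_lim_seq (fun n : nat => 1 / INR n * INR (odd_count n))
                (Finite (PI / 2 - 1)).
Proof.
split.
- exists 6, 0; intros n Hn _; apply odd_count_error, Hn.
- assert (Hsq : is_lim_seq (fun n => sqrt (INR n)) p_infty).
  { apply (filterlim_comp _ _ _ INR sqrt _ (Rbar_locally p_infty));
      [apply is_lim_seq_INR | apply filterlim_sqrt_p]. }
  assert (Hinv : is_lim_seq (fun n => 6 * / sqrt (INR n)) 0).
  { replace (Finite 0) with (Rbar_mult 6 (Rbar_inv p_infty)) by (simpl; f_equal; ring).
    apply is_lim_seq_scal_l, is_lim_seq_inv; [exact Hsq | discriminate]. }
  (* Squeeze: the error bound divided by n is 6 / sqrt n. The comparison is made from n = 1 on,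
     where division by n is meaningful. *)
  apply (is_lim_seq_le_le_loc
           (fun n => (PI / 2 - 1) - 6 * / sqrt (INR n)) _
           (fun n => (PI / 2 - 1) + 6 * / sqrt (INR n))).
  + exists 1%nat; intros n Hn.
    assert (H := odd_count_error n Hn); apply Rabs_le_between in H.
    assert (Hn0 : 0 < INR n) by (apply lt_0_INR; lia).
    assert (Hs : sqrt (INR n) * sqrt (INR n) = INR n) by (apply sqrt_sqrt; lra).
    assert (Hs0 : 0 < sqrt (INR n)) by (apply sqrt_lt_R0, Hn0).
    set (s := sqrt (INR n)) in *; set (c := INR (odd_count n)) in *.
    replace (1 / INR n * c) with (PI / 2 - 1 + (c - (PI / 2 - 1) * INR n) * / INR n)
      by (field; lra).
    replace (6 * / s) with (6 * s * / INR n) by (rewrite <- Hs; field; lra).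
    assert (Hi : 0 < / INR n) by (apply Rinv_0_lt_compat, Hn0).
    split; nra.
  + replace (Finite (PI / 2 - 1)) with (Finite (PI / 2 - 1 - 0)) by (f_equal; ring).
    apply is_lim_seq_minus'; [apply is_lim_seq_const | exact Hinv].
  + replace (Finite (PI / 2 - 1)) with (Finite (PI / 2 - 1 + 0)) by (f_equal; ring).
    apply is_lim_seq_plus'; [apply is_lim_seq_const | exact Hinv].
Qed.
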